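(* Let $W_n^\alpha$ be an infinite family (indexed by $n$) of non-genuine Steinberg crystallographic complex reflection groups. Then the regular orbit space $N_{W_n^\alpha}/W_n^\alpha$ is a configuration space for all $n$.
   Context: A complex reflection group $W$ here is a group of affine transformations of a finite-dimensional complex vector space $V$ generated by reflections, a reflection being a non-identity affine transformation of finite order fixing pointwise a complex affine hyperplane. If $W$ is infinite, irreducible and crystallographic, it is an extension of a lattice $\mathrm{Tran}(W)$ of translations, of rank $2\dim_{\mathbb C}V$, by a finite (Shephard–Todd) complex reflection group $\mathrm{Lin}(W)$, its linear part. $W$ is non-genuine if $\mathrm{Lin}(W)$ is the complexification of an irreducible finite Weyl group. Non-genuine groups have moduli, with a complex parameter $\alpha$ in the modular strip (the standard fundamental domain of $SL_2(\mathbb Z)$ on the upper half-plane). $N_W\subset V$ denotes the set of regular points, i.e. points with trivial stabilizer in $W$, and $N_W/W$ is the regular orbit space. $W$ is Steinberg if every vector of $V$ fixed by a non-identity element of $W$ lies on a reflection hyperplane of $W$; then $N_W$ is the complement in $V$ of all reflection hyperplanes. It is known (Puente–Shepler) that there are just two infinite families of non-genuine Steinberg crystallographic complex reflection groups. With $\Lambda_\alpha=\mathbb Z+\alpha\mathbb Z$, they are: (type A) $[G(1,1,n)]^\alpha=[W(A_{n-1})]^\alpha$, the affine transformations $z\mapsto gz+t$ of $V=\{z\in\mathbb C^n: z_1+\dots+z_n=0\}$ with $g\in\mathfrak S_n$ permuting coordinates and $t\in\Lambda_\alpha^n\cap V$; (type C) $[G(2,1,n)]_1^\alpha$, the affine transformations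 $z\mapsto gz+t$ of $V=\mathbb C^n$ with $g\in G(2,1,n)$ a signed permutation matrix and $t\in\Lambda_\alpha^n$. ''Configuration space'' is meant in the broad sense of a space of unordered $n$-tuples of pairwise distinct points on a surface, possibly restricted by a condition on the points (''special'' configurations). The lemma itself does not specify which configuration space occurs. The paper comments separately that type A corresponds to special configurations of $n$ points on the torus (those whose product is the identity of the torus), and type C to configurations of $n$ points on the four-punctured sphere. *)

(* Defs.v *)
From HB Require Import structures.
From mathcomp Require Import all_boot all_order all_algebra all_fingroup.
From mathcomp Require Import generic_quotient.
From mathcomp Require Import all_classical all_reals all_analysis.
From mathcomp Require Import complex.

Set Implicit Arguments.
Unset Strict Implicit.
Unset Printing Implicit Defensive.

Import Order.TTheory GRing.Theory Num.Theory.
Import numFieldNormedType.Exports.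

Local Open Scope classical_set_scope.
Local Open Scope ring_scope.
Local Open Scope complex_scope.
Local Open Scope quotient_scope.

Record transformation_group (X : Type) := TransformationGroup {
  elements : set (X -> X);
  tg_id : elements id;
  tg_comp : forall f g, elements f -> elements g -> elements (f \o g);
  tg_inv : forall f, elements f ->
    exists g, [/\ elements g, cancel f g & cancel g f] }.

Section OrbitSpace.
Context {X : topologicalType} (G : transformation_group X) (A : set X).

(* The set-type A carries the topology induced by X. *)
Definition orbit_rel (x y : A) : bool :=
  `[< exists2 g, elements G g & g (\val x) = \val y >].

Lemma orbit_rel_refl : reflexive orbit_rel.
Proof. by move=> x; apply/asboolP; exists id => //; exact: tg_id. Qed.

Lemma orbit_rel_sym : symmetric orbit_rel.
Proof.
suff sub x y : orbit_rel x y -> orbit_rel y x.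
  by move=> x y; apply/idP/idP; exact: sub.
move=> /asboolP[g Gg gxy]; have [h [Gh gK _]] := tg_inv Gg.
by apply/asboolP; exists h => //; rewrite -gxy gK.
Qed.

Lemma orbit_rel_trans : transitive orbit_rel.
Proof.
move=> y x z /asboolP[g Gg gxy] /asboolP[h Gh hyz]; apply/asboolP.
by exists (h \o g); [exact: tg_comp | rewrite /= gxy hyz].
Qed.

Canonical orbit_equiv :=
  EquivRel orbit_rel orbit_rel_refl orbit_rel_sym orbit_rel_trans.

(* When A is G-stable this is A / G. *)
Definition orbit_space : topologicalType :=
  quotient_topology {eq_quot orbit_equiv}.

End OrbitSpace.

Definition homeomorphic (X Y : topologicalType) : Prop :=
  exists (f : X -> Y) (g : Y -> X),
    [/\ continuous f, continuous g, cancel f g & cancel g f].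

Section AffineGroups.
Context {R : realType} {V : vectType R[i]}.
Implicit Types (f : V -> V) (W : transformation_group V).

Definition affine_transformation f : Prop :=
  exists (g : 'End(V)) (t : V), lker g == 0%VS /\ forall x, f x = g x + t.

Definition affine_hyperplane (H : set V) : Prop :=
  exists (p : V) (U : {vspace V}),
    (\dim U).+1 = \dim {:V} /\ H = [set x | x - p \in U].

Definition is_reflection f : Prop :=
  [/\ affine_transformation f, f <> id,
      exists m, (0 < m)%N /\ iter m f =1 id &
      exists2 H, affine_hyperplane H & forall x, H x -> f x = x].

Definition reflection_hyperplane W (H : set V) : Prop :=
  affine_hyperplane H /\
  exists r, [/\ elements W r, is_reflection r & forall x, H x -> r x = x].

Definition complex_reflection_group W : Prop :=
  (forall f, elements W f -> affine_transformation f) /\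
  (forall G : transformation_group V,
     (forall r, elements W r -> is_reflection r -> elements G r) ->
     elements W `<=` elements G).

Definition Lin W : set 'End(V) :=
  [set g | exists2 f, elements W f & exists t, forall x, f x = g x + t].

Definition Tran W : set V := [set t | elements W (fun x => x + t)].

Definition full_lattice (L : set V) : Prop :=
  exists b : 'I_(2 * \dim {:V}) -> V,
    (forall c : 'I_(2 * \dim {:V}) -> R,
       \sum_i (c i)%:C *: b i = 0 -> forall i, c i = 0) /\
    L = [set x | exists k : 'I_(2 * \dim {:V}) -> int, x = \sum_i b i *~ k i].

Definition crystallographic W : Prop :=
  full_lattice (Tran W) /\ finite_set (Lin W).

Definition irreducible_group W : Prop :=
  (0 < \dim {:V})%N /\
  forall U : {vspace V}, (forall g, Lin W g -> (g @: U <= U)%VS) ->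
    U = 0%VS \/ U = fullv.

Definition steinberg W : Prop :=
  forall w x, elements W w -> w <> id -> w x = x ->
    exists2 H, reflection_hyperplane W H & H x.

Definition regular_points W : set V :=
  [set x | forall w, elements W w -> w x = x -> w = id].

End AffineGroups.

Section Weyl.
Context {R : realType} {d : nat}.
Implicit Types (a b : 'rV[R]_d) (Phi : seq 'rV[R]_d).

Definition dotp a b : R := (a *m b^T) 0 0.

Definition cartan_int b a : R := 2 * dotp b a / dotp a a.

(* Acts on row vectors from the right: b *m root_refl a = b - cartan_int b a *: a. *)
Definition root_refl a : 'M[R]_d := 1%:M - (2 / dotp a a) *: (a^T *m a).

Definition root_system Phi : Prop :=
  [/\ 0 \notin Phi, (<<Phi>> = fullv)%VS,
      {in Phi &, forall a b, b *m root_refl a \in Phi},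
      {in Phi &, forall a b, cartan_int b a \is a Num.int} &
      {in Phi, forall a (c : R), c *: a \in Phi -> c = 1 \/ c = -1}].

Definition irreducible_root_system Phi : Prop :=
  [/\ (0 < d)%N, root_system Phi &
      forall P : pred 'rV[R]_d, has P Phi -> has (predC P) Phi ->
        exists a b, [/\ a \in Phi, b \in Phi, P a, ~~ P b & dotp a b != 0]].

Definition weyl_group Phi : set 'M[R]_d :=
  [set M | exists2 s : seq 'rV[R]_d, {subset s <= Phi} &
           M = \big[mulmx/1%:M]_(a <- s) root_refl a].

End Weyl.

Definition nongenuine {R : realType} {V : vectType R[i]}
    (W : transformation_group V) : Prop :=
  exists2 Phi : seq 'rV[R]_(\dim {:V}), irreducible_root_system Phi &
  exists2 phi : 'Hom(V, 'rV[R[i]]_(\dim {:V})), lker phi == 0%VS &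
    Lin W = [set g | exists2 M, weyl_group Phi M &
      forall v, phi (g v) = phi v *m map_mx (real_complex R) M].

Definition nongenuine_steinberg_crystallographic {R : realType}
    {V : vectType R[i]} (W : transformation_group V) : Prop :=
  [/\ complex_reflection_group W, infinite_set (elements W) & irreducible_group W] /\
  [/\ crystallographic W, nongenuine W & steinberg W].

Section Families.
Context {R : realType}.
Local Notation C := R[i].

(* The boundary of the fundamental domain is kept on its left half only. *)
Definition modular_strip (alpha : C) : Prop :=
  [/\ 0 < complex.Im alpha,
      - 2^-1 <= complex.Re alpha < 2^-1,
      1 <= complex.Re alpha ^+ 2 + complex.Im alpha ^+ 2 &
      complex.Re alpha ^+ 2 + complex.Im alpha ^+ 2 = 1 -> complex.Re alpha <= 0].

Definition Lambda (alpha : C) : set C :=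
  [set x | exists a b : int, x = a%:~R + b%:~R * alpha].

Definition zero_sum (n : nat) : {vspace 'rV[C]_n} :=
  lker (linfun (mulmxr (const_mx 1 : 'M[C]_(n, 1)))).

Lemma zero_sumP n (z : 'rV[C]_n) : (z \in zero_sum n) = (\sum_i z 0 i == 0).
Proof.
rewrite memv_ker lfunE /=.
have zE i j : (z *m (const_mx 1 : 'M[C]_(n, 1))) i j = \sum_k z 0 k.
  by rewrite mxE ord1; apply: eq_bigr => k _; rewrite mxE mulr1.
apply/eqP/eqP => [z0|z0]; first by rewrite -(zE 0 0) z0 mxE.
by apply/matrixP => i j; rewrite zE z0 mxE.
Qed.

(* [G(1,1,n)]^alpha *)
Definition typeA_group (alpha : C) (n : nat) :
    set (subvs_of (zero_sum n) -> subvs_of (zero_sum n)) :=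
  [set f | exists (s : 'S_n) (t : subvs_of (zero_sum n)),
     (forall i, Lambda alpha (vsval t 0 i)) /\
     forall z, vsval (f z) = vsval z *m perm_mx s + vsval t].

Definition signed_perm_mx (n : nat) (e : 'I_n -> bool) (s : 'S_n) : 'M[C]_n :=
  diag_mx (\row_i (-1) ^+ e i) *m perm_mx s.

(* [G(2,1,n)]_1^alpha *)
Definition typeC_group (alpha : C) (n : nat) : set ('rV[C]_n -> 'rV[C]_n) :=
  [set f | exists (e : 'I_n -> bool) (s : 'S_n) (t : 'rV[C]_n),
     (forall i, Lambda alpha (t 0 i)) /\
     forall z, f z = z *m signed_perm_mx e s + t].

Arguments typeA_group alpha n : clear implicits.
Arguments typeC_group alpha n : clear implicits.

Definition affinely_equivalent (V V' : vectType C)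
    (W : set (V -> V)) (W' : set (V' -> V')) : Prop :=
  exists (L : 'Hom(V, V')) (p : V'),
    [/\ lker L == 0%VS, limg L = fullv &
        forall f, W f <-> exists2 f', W' f' &
          forall v, L (f v) + p = f' (L v + p)].

(* The members of the family are the W n with n0 <= n. By the classification of
   Puente and Shepler such a family is of type A or of type C; irreducibility
   forces 1 < n0 in type A and 0 < n0 in type C. *)
Definition infinite_family (alpha : C) (n0 : nat) (V : nat -> vectType C)
    (W : forall n, transformation_group (V n)) : Prop :=
  (forall n, (n0 <= n)%N -> nongenuine_steinberg_crystallographic (W n)) /\
  ((forall n, (n0 <= n)%N ->
      affinely_equivalent (elements (W n)) (typeA_group alpha n)) \/
   (forall n, (n0 <= n)%N ->
      affinely_equivalent (elements (W n)) (typeC_group alpha n))).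

End Families.

(* The topology of a finite-dimensional complex vector space, read off from the
   coordinates in a basis; R[i] carries its norm topology only as R[i]^o. *)
Definition vect_topology {R : realType} (V : vectType R[i]) : topologicalType :=
  initial_topology
    (fun v : V => \row_i coord (vbasis {:V}) i v : 'rV[R[i]^o]_(\dim {:V})).

Definition regular_orbit_space {R : realType} {V : vectType R[i]}
    (W : transformation_group V) : topologicalType :=
  @orbit_space (vect_topology V) W (regular_points W).

Definition surface (R : realType) (S : topologicalType) : Prop :=
  [/\ hausdorff_space S, @second_countable S, connected [set: S] &
      forall x : S, exists (U : set S) (f : S -> R * R) (g : R * R -> S),
        [/\ open U /\ U x, open (f @` U), {in U, cancel f g},
            {within U, continuous f} & {within f @` U, continuous g}]].

Section Configurations.
Context (n : nat) (S : topologicalType).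

Definition tuples : topologicalType := prod_topology (fun _ : 'I_n => S).

Definition permutation_set : set (tuples -> tuples) :=
  [set f | exists s : 'S_n, forall (x : 'I_n -> S) i, f x i = x (s i)].

Lemma permutation_id : permutation_set id.
Proof. by exists 1%g => x i; rewrite perm1. Qed.

Lemma permutation_comp f g :
  permutation_set f -> permutation_set g -> permutation_set (f \o g).
Proof.
by move=> [s fs] [t gt]; exists (s * t)%g => x i; rewrite /= fs gt permM.
Qed.

Lemma permutation_inv f : permutation_set f ->
  exists g, [/\ permutation_set g, cancel f g & cancel g f].
Proof.
move=> [s fs]; exists (fun x : 'I_n -> S => x \o (s^-1)%g); split.
- by exists (s^-1)%g.
- by move=> x; apply/funext => i; rewrite /= fs permKV.
- by move=> x; apply/funext => i; rewrite fs /= permK.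
Qed.

Definition permutations : transformation_group tuples :=
  TransformationGroup permutation_id permutation_comp permutation_inv.

Definition unordered_configurations (P : set tuples) : topologicalType :=
  orbit_space permutations [set x : 'I_n -> S | injective x /\ P x].

End Configurations.

(* All configurations of n points on a surface, or the special ones: those with
   trivial product for a commutative topological group structure, which MathComp
   writes additively. *)
Definition configuration_space (R : realType) (n : nat) (X : topologicalType) :
    Prop :=
  (exists S : topologicalType, surface R S /\
     homeomorphic X (@unordered_configurations n S setT)) \/
  (exists S : topologicalZmodType, surface R S /\
     homeomorphic X (@unordered_configurations n S
                       [set x : 'I_n -> S | \sum_(i < n) x i = 0])).

(* Main.v *)
From HB Require Import structures.
Require Import Defs.
From mathcomp Require Import all_boot all_order all_algebra.
From mathcomp Require Import perm generic_quotient ring_quotient.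
From mathcomp Require Import all_classical all_reals all_analysis.
From mathcomp Require Import complex ring lra.

Set Implicit Arguments.
Unset Strict Implicit.
Unset Printing Implicit Defensive.

Import Order.TTheory GRing.Theory Num.Theory.
Import numFieldNormedType.Exports.

Local Open Scope classical_set_scope.
Local Open Scope ring_scope.
Local Open Scope quotient_scope.

(** Write a point of V, through the affine isomorphism of the hypothesis, as a
    tuple of complex numbers, and each complex number a + b alpha, with a and b
    real, as the point (a, b) of the plane R * R.  The group W becomes a group
    of transformations z_i |-> +- z_(s i) + t_i of n-tuples of points of the
    plane, with t_i integral; in type A there are no signs and the tuples sum
    to zero.  So W-orbits of tuples are unordered tuples of orbits of the plane
    group Gamma = Z^2 (type A) or Gamma = Z^2 extended by -1 (type C).  A tuple
    has a trivial stabilizer exactly when its points lie in different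
    Gamma-orbits and, in type C, none of them is half-integral, that is, fixed
    by an element x |-> - x + t of Gamma ([lattice_regular]).  Hence the regular
    orbit space is the space of unordered configurations of n points on the
    surface S, quotient by Gamma of the locus A of the plane where Gamma acts
    freely: the torus in type A, and the sphere minus four points in type C.  In
    type A the condition that coordinates sum to zero becomes the condition that
    the points sum to zero in the torus, since a tuple whose sum is integral can
    be translated by an integral vector into one of sum zero.

    Both families are treated at once, with a boolean b telling whether Gamma
    contains the maps x |-> - x + t.  The only facts used about S are those of
    [lattice_quotient]: it is a topological quotient of A by Gamma.  They make
    the projection A -> S continuous and open; as Gamma acts freely and
    properly discontinuously on A, which is connected, S is a surface
    ([lattice_quotient_surface]).  They also make the map from regular points to
    configurations continuous and open: openness uses that integral vectors are
    isolated, so that a lift close to a tuple of sum zero, with integral sum,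
    has sum zero ([balanced_near]).  A continuous open surjection that matches
    orbits induces a homeomorphism of orbit spaces
    ([homeomorphic_orbit_spaces]). *)

(** * Orbit spaces *)

Section OrbitSpaces.
Context {X : topologicalType} (G : transformation_group X) (A : set X).

Definition orbit (x : A) : orbit_space G A := \pi x.

Lemma orbit_eq (x y : A) :
  orbit x = orbit y <-> exists2 g, elements G g & g (\val x) = \val y.
Proof.
split=> [/eqquotP/asboolP//|xy].
by apply/eqquotP/asboolP.
Qed.

Lemma orbit_surj (y : orbit_space G A) : exists x, orbit x = y.
Proof. by exists (repr y); rewrite /orbit reprK. Qed.

Lemma open_orbit_space (U : set (orbit_space G A)) :
  open U = open (orbit @^-1` U).
Proof. by []. Qed.

Lemma orbit_continuous : continuous orbit.
Proof. exact: pi_continuous. Qed.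

End OrbitSpaces.

Lemma nbhs_set_type (X : topologicalType) (A : set X) (a : A) (N : set A) :
  nbhs a N <->
  exists2 M : set X, nbhs (\val a) M & forall b : A, M (\val b) -> N b.
Proof.
split=> [[_ [[M oM <-] Ma] MN]|[M Ma MN]].
  by exists M => //; exact: open_nbhs_nbhs.
apply: (@filterS A (nbhs a) _ (\val @^-1` M)) => [b|]; first exact: MN.
exact: (@initial_continuous A X \val a M Ma).
Qed.

(** Openness of [f] is only required relatively to [B]; this is what
    configurations with a prescribed sum need.  It makes [f] a quotient map from
    [A] onto [B], so that a map out of [orbit_space H B] is continuous as soon
    as its composite with [A -> B -> orbit_space H B] is. *)
Lemma homeomorphic_orbit_spaces (X Y : topologicalType)
    (G : transformation_group X) (H : transformation_group Y)
    (A : set X) (B : set Y) (f : X -> Y) :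
    (forall a, A a -> B (f a)) ->
    (forall a, A a -> {for a, continuous f}) ->
    (forall b, B b -> exists2 a, A a & f a = b) ->
    (forall a N, A a -> nbhs a N ->
      nbhs (f a) [set b | B b -> exists a', [/\ A a', N a' & f a' = b]]) ->
    (forall a a', A a -> A a' ->
      (exists2 g, elements G g & g a = a') <->
      (exists2 h, elements H h & h (f a) = f a')) ->
  homeomorphic (orbit_space G A) (orbit_space H B).
Proof.
move=> fAB fcont fsurj fopen orbits.
pose fA (a : A) : B := exist _ (f (\val a)) (mem_set (fAB _ (set_valP a))).
have fA_orbit (a a' : A) :
    orbit G a = orbit G a' <-> orbit H (fA a) = orbit H (fA a').
  by split=> /orbit_eq aa'; apply/orbit_eq; apply/orbits => //; exact: set_valP.
have fA_surj (b : B) : exists a, fA a = b.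
  have [a Aa ab] := fsurj _ (set_valP b).
  by exists (exist _ a (mem_set Aa)); apply/val_inj.
have fA_cont : continuous fA.
  move=> a N /nbhs_set_type[M Mfa MN]; apply/nbhs_set_type.
  exists (f @^-1` M); first exact: (fcont _ (set_valP a)).
  by move=> b Mb; exact: MN.
have fA_open (U : set A) : open U -> open (fA @` U).
  rewrite !openE => oU _ [a Ua <-]; have /nbhs_set_type[M Ma MU] := oU _ Ua.
  apply/nbhs_set_type; eexists; first exact: fopen (set_valP a) Ma.
  move=> b /(_ (set_valP b))[a' [Aa' Ma' a'b]].
  exists (exist _ a' (mem_set Aa')); first exact: MU.
  exact/val_inj.
pose F (x : orbit_space G A) : orbit_space H B := orbit H (fA (repr x)).
have FE a : F (orbit G a) = orbit H (fA a).
  by apply/fA_orbit; rewrite /orbit reprK.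
have /choice[Ginv GinvE] : forall y : orbit_space H B, exists x, F x = y.
  move=> y; have [b <-] := orbit_surj y; have [a <-] := fA_surj b.
  by exists (orbit G a).
have F_inj : injective F.
  move=> x x'; have [a <-] := orbit_surj x; have [a' <-] := orbit_surj x'.
  by rewrite !FE => /fA_orbit.
exists F, Ginv; split => //.
- apply/continuousP => U oU; rewrite open_orbit_space -comp_preimage.
  have -> : F \o orbit G (A := A) = orbit H (A := B) \o fA.
    by apply/funext => a /=; exact: FE.
  apply: open_comp => // x _.
  by apply: continuous_comp; [exact: fA_cont | exact: orbit_continuous].
- apply/continuousP => U oU; rewrite open_orbit_space.
  have -> : orbit H (A := B) @^-1` (Ginv @^-1` U) =
      fA @` (orbit G (A := A) @^-1` U).
    apply/seteqP; split=> [b /= Ub|_ [a /= Ua <-]].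
      have [a ab] := fA_surj b; exists a => //=.
      by move: Ub; rewrite -ab -FE; have /F_inj -> := GinvE (F (orbit G a)).
    by rewrite /= -FE; have /F_inj -> := GinvE (F (orbit G a)).
  by apply: fA_open; rewrite -open_orbit_space.
- by move=> x; apply: F_inj; rewrite GinvE.
Qed.

(** * The integral lattice of the plane *)

Section Plane.
Context {R : realType}.
Local Notation plane := (R * R)%type.
Implicit Types (u v x y : plane) (b e : bool).

Definition Z2 : {pred plane} :=
  [pred u : plane | (u.1 \is a Num.int) && (u.2 \is a Num.int)].

Lemma Z2P u : (u \in Z2) = (u.1 \is a Num.int) && (u.2 \is a Num.int).
Proof. by []. Qed.

Lemma Z2_zmod_closed : zmod_closed Z2.
Proof.
split=> [|u v]; first by rewrite Z2P /= rpred0.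
by rewrite !Z2P => /andP[u1 u2] /andP[v1 v2]; apply/andP; split; exact: rpredB.
Qed.
HB.instance Definition _ := GRing.isZmodClosed.Build plane Z2 Z2_zmod_closed.

Lemma small_Z2 u : u \in Z2 -> `|u| < 1 -> u = 0.
Proof.
have int0 (z : R) : z \is a Num.int -> `|z| < 1 -> z = 0.
  move=> zint; apply: contraTeq => z0; rewrite -leNgt.
  exact: norm_intr_ge1.
case: u => a c; rewrite Z2P /= => /andP[aint cint].
by rewrite prod_normE /= gt_max => /andP[/int0-> // /int0->].
Qed.

(** Integers are closed in the line: a non-integer stays between its floor and
    the next integer. *)
Lemma near_notin_int (x : R) : x \isn't a Num.int ->
  \forall y \near x, y \isn't a Num.int.
Proof.
move=> xNint.
have [lo hi] : (Num.floor x)%:~R < x /\ x < (Num.floor x + 1)%:~R.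
  split; last exact: floorD1_gt.
  by rewrite lt_neqAle floor_le -intrEfloor xNint.
near=> y; apply/negP => /intrP[m ym].
have : (Num.floor x)%:~R < y by near: y; exact: lt_nbhsr.
have : y < (Num.floor x + 1)%:~R by near: y; exact: lt_nbhsl.
by rewrite ym !ltr_int ltzD1 leNgt => /negP.
Unshelve. all: by end_near. Qed.

Lemma near_notin_Z2 u : u \notin Z2 -> \forall v \near u, v \notin Z2.
Proof.
rewrite Z2P negb_and => /orP[] /near_notin_int uN.
  exists ([set a : R | a \isn't a Num.int], setT).
    by split => //; exact: filterT.
  by move=> v [/negPf/= vN _]; rewrite Z2P vN.
exists (setT, [set a : R | a \isn't a Num.int]).
  by split => //; exact: filterT.
by move=> v [_ /negPf/= vN]; rewrite Z2P vN andbF.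
Qed.

Definition flip e u : plane := if e then - u else u.

Lemma flip_continuous e : continuous (flip e).
Proof. by case: e => x /=; [exact: opp_continuous | exact: cvg_id]. Qed.

Lemma flipK e : involutive (flip e).
Proof. by case: e => u //=; rewrite opprK. Qed.

Lemma flipD e : {morph flip e : u v / u + v}.
Proof. by case: e => u v //=; rewrite opprD. Qed.

Lemma flipB e : {morph flip e : u v / u - v}.
Proof. by case: e => u v //=; rewrite opprB opprK addrC. Qed.

Lemma flip_Z2 e u : (flip e u \in Z2) = (u \in Z2).
Proof. by case: e; rewrite //= rpredN. Qed.

End Plane.

(** * Quotients of the plane by lattice groups *)

Section LatticeQuotient.
Context {R : realType}.
Local Notation plane := (R * R)%type.
Implicit Types (u v x y : plane) (e : bool).

(** The orbit relation of the group of maps [x |-> flip e x + t] with [t] in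
    [Z2], where [e] can be true only if [b] is. *)
Definition lattice_equiv (b : bool) x y : Prop :=
  exists2 e : bool, e ==> b & y - flip e x \in Z2.

(** A map [x |-> - x + t] fixes [x] exactly when [x + x = t]; translations have
    no fixed points. *)
Definition free_locus (b : bool) : set plane :=
  [set x | b -> x + x \notin Z2].

(** The space [S] is the topological quotient of [free_locus b] by
    [lattice_equiv b]; to stay away from subtypes, the projection is extended
    arbitrarily to a function [q] on the plane. *)
Definition lattice_quotient (b : bool) (S : topologicalType) (q : plane -> S) :=
  [/\ forall x y, free_locus b x -> free_locus b y ->
        (q x = q y <-> lattice_equiv b x y),
      forall s, exists2 x, free_locus b x & q x = s &
      forall U : set S, open U <-> open (free_locus b `&` q @^-1` U)].

(** The source of both separation statements below: as [Z2] is closed, not being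
    related by a map of given sign is an open condition on a pair of points. *)
Lemma near_diff_notin_Z2 e x y : y - flip e x \notin Z2 ->
  exists N M, [/\ nbhs x N, nbhs y M &
    forall x' y', N x' -> M y' -> y' - flip e x' \notin Z2].
Proof.
move=> xyN.
have cont : {for (x, y),
    continuous (fun z : plane * plane => z.2 - flip e z.1)}.
  apply: cvgB; first exact: cvg_snd.
  by apply: continuous_comp; [exact: cvg_fst | exact: flip_continuous].
have [[N M] /= [Nx My] NM] := cont _ (near_notin_Z2 xyN).
by exists N, M; split=> // x' y' Nx' My'; apply: (NM (x', y')).
Qed.

Variable b : bool.
Local Notation A := (free_locus b).
Local Notation sim := (lattice_equiv b).

Lemma lattice_equiv_refl x : sim x x.
Proof. by exists false => //=; rewrite subrr rpred0. Qed.

Lemma lattice_equiv_free x y : sim x y -> A x -> A y.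
Proof.
move=> [e _ xy] Ax /Ax; apply: contra => yy.
have -> : x + x = flip e (y + y) -
    (flip e (y - flip e x) + flip e (y - flip e x)).
  by case: e {xy} => /=; rewrite ?opprK; ring.
by rewrite rpredB ?rpredD ?flip_Z2.
Qed.

Lemma open_free_locus : open A.
Proof.
rewrite openE => x Ax; case: b Ax => [/(_ isT) xxN|_]; last first.
  by apply: filterS filterT.
have := @near_diff_notin_Z2 true x x; rewrite /= opprK => /(_ xxN).
move=> [N [M [Nx Mx NM]]]; near=> y.
have /NM : N y by near: y.
by move=> /(_ y); rewrite /= opprK => h _; apply: h; near: y.
Unshelve. all: by end_near. Qed.

(** Each map [x |-> flip e x + t] is a homeomorphism, so the union of the
    images of an open set is open. *)
Lemma open_saturation (N : set plane) : open N ->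
  open [set y | exists2 x, N x & sim x y].
Proof.
rewrite !openE => oN y [x Nx [e eb xy]].
pose t : plane := y - flip e x.
have cont : {for y, continuous (fun z : plane => flip e (z - t))}.
  apply: continuous_comp; last exact: flip_continuous.
  by apply: cvgB; [exact: cvg_id | exact: cvg_cst].
have yx : flip e (y - t) = x by rewrite /t subKr flipK.
have nN : nbhs y ((fun z : plane => flip e (z - t)) @^-1` N).
  by apply: cont; rewrite yx; exact: oN.
apply: (@filterS _ (nbhs y) _ _ _ _ nN) => z /= Nz.
exists (flip e (z - t)) => //.
by exists e => //; rewrite flipK subKr.
Qed.

(** Close points cannot differ by a nonzero integral vector, and, as [x + x] is
    not integral, neither is the sum of two points close to [x]. *)
Lemma locally_discrete_equiv x : A x -> exists2 N, nbhs x N &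
  forall y z, N y -> N z -> sim y z -> y = z.
Proof.
move=> Ax.
have [N [Nx NA]] : exists N, nbhs x N /\
    forall y z, N y -> N z -> b -> z + y \notin Z2.
  have [bT|bF] := boolP b; last by exists setT; split=> // *; exact: filterT.
  have xxN := Ax bT.
  have := @near_diff_notin_Z2 true x x; rewrite /= opprK => /(_ xxN).
  move=> [N [M [Nx Mx NM]]]; exists (N `&` M); split; first exact: filterI.
  by move=> y z [Ny _] [_ Mz] _; have := NM _ _ Ny Mz; rewrite /= opprK.
exists (N `&` ball x (2^-1 : R)).
  by apply: filterI => //; apply: nbhsx_ballx; rewrite invr_gt0.
move=> y z [Ny xy] [Nz xz] [[] /= eb yz].
  by move: yz; rewrite opprK; have /negPf-> := NA _ _ Ny Nz eb.
apply/esym/eqP; rewrite -subr_eq0; apply/eqP; apply: small_Z2 => //.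
move: xy xz; rewrite -!ball_normE /= => xy xz.
have -> : z - y = (x - y) - (x - z) by ring.
apply: le_lt_trans (ler_normB _ _) _.
by rewrite [1]splitr div1r ltrD.
Qed.

Lemma separated_equiv x y : ~ sim x y -> exists N M,
  [/\ nbhs x N, nbhs y M & forall x' y', N x' -> M y' -> ~ sim x' y'].
Proof.
move=> xyN.
have P e : exists N M, [/\ nbhs x N, nbhs y M &
    e ==> b -> forall x' y', N x' -> M y' -> y' - flip e x' \notin Z2].
  case: (boolP (e ==> b)) => eb; last first.
    by exists setT, setT; split=> //; exact: filterT.
  have [|N [M [Nx My NM]]] := @near_diff_notin_Z2 e x y.
    by apply/negP => xy; apply: xyN; exists e.
  by exists N, M; split=> // _; exact: NM.
have [N [M [Nx My NM]]] := P false; have [N' [M' [Nx' My' NM']]] := P true.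
exists (N `&` N'), (M `&` M'); split; [exact: filterI|exact: filterI|].
move=> x' y' [? ?] [? ?] [e eb]; apply/negP.
by case: e eb => eb; [exact: NM' | exact: NM].
Qed.

Section Projection.
Variables (S : topologicalType) (q : plane -> S).
Hypothesis qP : lattice_quotient b q.

Lemma lattice_quotient_continuous x : A x -> {for x, continuous q}.
Proof.
case: qP => _ _ qopen Ax N; rewrite nbhsE => -[U [oU Ux] UN].
have : nbhs x (A `&` q @^-1` U).
  by apply: open_nbhs_nbhs; split; [exact/qopen | split].
by apply: filterS => y [_ /UN].
Qed.

Lemma lattice_quotient_open x (N : set plane) : A x -> nbhs x N ->
  nbhs (q x) (q @` (N `&` A)).
Proof.
case: qP => qeq _ qopen Ax; rewrite (nbhsE x) => -[U [oU Ux] UN].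
have : nbhs (q x) (q @` (U `&` A)).
  apply: open_nbhs_nbhs; split; last by exists x.
  apply/qopen; rewrite (_ : _ `&` _ =
    [set y | exists2 x, (U `&` A) x & sim x y]); last first.
    apply/seteqP; split=> [y [Ay /= [z [Uz Az] /qeq]]|y /= [z [Uz Az] zy]].
      by move=> /(_ Az Ay) zy; exists z.
    have Ay := lattice_equiv_free zy Az.
    by split=> //; exists z => //; exact/qeq.
  by apply: open_saturation; apply: openI => //; exact: open_free_locus.
by apply: filterS => _ [y [Uy Ay] <-]; exists y => //; split => //; exact: UN.
Qed.

End Projection.
End LatticeQuotient.

(** * These quotients are surfaces *)

Section QuotientSurface.
Context {R : realType}.
Local Notation plane := (R * R)%type.
Implicit Types x y : plane.
Variable b : bool.
Local Notation A := (@free_locus R b).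

Lemma double_fourth_not_int : 4^-1 + 4^-1 \isn't a @Num.int R.
Proof.
apply/negP => half_int.
have half0 : 4^-1 + 4^-1 != 0 :> R by rewrite lt0r_neq0 ?addr_gt0 ?invr_gt0.
by have := norm_intr_ge1 half_int half0; rewrite ger0_norm; lra.
Qed.

(** One of the two coordinate lines through a point of the free locus stays in
    it; it meets one of the two lines on which a coordinate is 1/4, which stay
    there as well and cross at [o]. *)
Lemma connected_free_locus : connected A.
Proof.
have line_connected (f : R -> plane) : continuous f -> connected (range f).
  move=> cf; apply: connected_continuous_connected;
    last exact: continuous_subspaceT.
  by apply/connected_intervalP.
have vert_connected (a : R) : connected (range (fun t : R => (a, t) : plane)).
  apply: line_connected => t.
  exact: (cvg_pair (cvg_cst a) (@cvg_id _ (nbhs t))).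
have hor_connected (a : R) : connected (range (fun t : R => (t, a) : plane)).
  apply: line_connected => t.
  exact: (cvg_pair (@cvg_id _ (nbhs t)) (cvg_cst a)).
have free1 x : x.1 + x.1 \isn't a Num.int -> A x.
  by move=> xN _; rewrite Z2P /= negb_and xN.
have free2 x : x.2 + x.2 \isn't a Num.int -> A x.
  by move=> xN _; rewrite Z2P /= negb_and xN orbT.
pose o : plane := (4^-1, 4^-1).
have path x : A x -> exists C, [/\ connected C, C `<=` A, C o & C x].
  move=> Ax; case: (pselect (forall t, A (x.1, t))) => [Av|].
    exists (range (fun t : R => (x.1, t) : plane) `|`
            range (fun t : R => (t, 4^-1) : plane)); split.
    - by apply: connectedU => //; exists (x.1, 4^-1); split; eexists.
    - move=> _ [[t _ <-]|[t _ <-]]; first exact: Av.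
      by apply: free2; exact: double_fourth_not_int.
    - by right; exists 4^-1.
    - by left; exists x.2 => //; case: (x).
  move=> AvN; exists (range (fun t : R => (t, x.2) : plane) `|`
            range (fun t : R => (4^-1, t) : plane)); split.
  - by apply: connectedU => //; exists (4^-1, x.2); split; eexists.
  - move=> _ [[t _ <-]|[t _ <-]]; last first.
      by apply: free1; exact: double_fourth_not_int.
    move=> bT; apply: free2 => //=; apply/negP => x2int; apply: AvN => s.
    apply: free1 => /=; have := Ax bT; rewrite Z2P negb_and => /orP[//|].
    by rewrite x2int.
  - by right; exists 4^-1.
  - by left; exists x.1 => //; case: (x).
have -> : A = \bigcup_(C in [set C | [/\ connected C, C `<=` A & C o]]) C.
  apply/seteqP; split=> [x /path[C [? ? ? ?]]|x [C [_ CA _]]]; last exact: CA.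
  by exists C.
by apply: bigcup_connected => [|C []//]; exists o => C [].
Qed.

Variables (S : topologicalType) (q : plane -> S).
Hypothesis qP : lattice_quotient b q.

Lemma lattice_quotient_hausdorff : hausdorff_space S.
Proof.
have [qeq qsurj _] := qP.
move=> s t; have [x Ax <-] := qsurj s; have [y Ay <-] := qsurj t => xy.
apply/qeq => //; apply: contrapT => /separated_equiv[N [M [Nx My NM]]].
have [_ [[x' [Nx' Ax'] <-] [y' [My' Ay'] /esym/qeq]]] :=
  xy _ _ (lattice_quotient_open qP Ax Nx) (lattice_quotient_open qP Ay My).
by move=> /(_ Ax' Ay'); exact: NM.
Qed.

Lemma lattice_quotient_connected : connected [set: S].
Proof.
have -> : [set: S] = q @` A.
  apply/seteqP; split=> // s _; have [_ qsurj _] := qP.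
  by have [x Ax <-] := qsurj s; exists x.
apply: connected_continuous_connected; first exact: connected_free_locus.
rewrite continuous_open_subspace; last exact: open_free_locus.
by move=> x /set_mem; exact: lattice_quotient_continuous.
Qed.

(** The projection is open, so the images of boxes with rational centres and
    radii 1/(k+1) form a basis. *)
Lemma lattice_quotient_second_countable : @second_countable S.
Proof.
have [_ qsurj _] := qP.
pose box (k : rat * rat * nat) : set plane :=
  ball ((ratr k.1.1, ratr k.1.2) : plane) (k.2.+1%:R^-1 : R).
exists [set q @` (box k `&` A) | k in setT].
  by apply: sub_countable (countableP _); exact: card_image_le.
split=> [_ [k _ <-]|s N].
  rewrite openE => _ [x [kx Ax] <-]; apply: (lattice_quotient_open qP Ax).
  exact: (open_nbhs_nbhs (conj (ball_open _ _) kx)).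
have [x Ax <-] := qsurj s => /(lattice_quotient_continuous qP Ax).
move=> /nbhs_ballP[e /= e0 eN].
have [k ke] : exists k : nat, k.+1%:R^-1 + k.+1%:R^-1 < e.
  have e20 : 0 < e / 2 by rewrite divr_gt0.
  have [k] := ltr_add_invr e20; rewrite add0r => ke; exists k.
  by rewrite [e]splitr ltrD.
have k0 : 0 < k.+1%:R^-1 :> R by rewrite invr_gt0.
have rat_near (z : R) : exists r : rat, `|z - ratr r| < k.+1%:R^-1.
  have lt : z - k.+1%:R^-1 < z + k.+1%:R^-1.
    by rewrite ltrBlDr -addrA ltrDl addr_gt0.
  have [r] := rat_in_itvoo lt; rewrite in_itv /= => /andP[lo hi]; exists r.
  by rewrite ltr_distl ltrBlDr hi -ltrBlDr lo.
have [r1 xr1] := rat_near x.1; have [r2 xr2] := rat_near x.2.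
have kx : box (r1, r2, k) x.
  by split; rewrite -ball_normE /= distrC.
exists (q @` (box (r1, r2, k) `&` A)).
  by split; [exists (r1, r2, k) | exists x].
move=> _ [y [ky Ay] <-]; apply: eN; apply: le_ball (ltW ke) _ _.
exact: ball_triangle (ball_sym kx) ky.
Qed.

(** A neighborhood on which [q] is injective is its own chart: there [q] is an
    open embedding, and the coordinate map is its inverse. *)
Lemma lattice_quotient_chart (s : S) :
  exists (U : set S) (f : S -> plane) (g : plane -> S),
    [/\ open U /\ U s, open (f @` U), {in U, cancel f g},
        {within U, continuous f} & {within f @` U, continuous g}].
Proof.
have [qeq qsurj _] := qP; have [x Ax <-] := qsurj s.
have [N0 Nx0 Ninj0] := locally_discrete_equiv Ax.
pose N := N0° `&` A.
have oN : open N.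
  by apply: openI; [exact: open_interior | exact: open_free_locus].
have NA y : N y -> A y by case.
have Ninj y z : N y -> N z -> q y = q z -> y = z.
  move=> [/interior_subset Ny Ay] [/interior_subset Nz Az] /qeq yz.
  by apply: Ninj0 => //; exact: yz.
pose f t : plane := xget x [set y | N y /\ q y = t].
have fq y : N y -> f (q y) = y.
  move=> Ny; have [Nf qf] : [set z | N z /\ q z = q y] (f (q y)).
    by apply: xgetPex; exists y.
  exact: Ninj.
have fU : f @` (q @` N) = N.
  apply/seteqP; split=> [_ [_ [y Ny <-] <-]|y Ny]; first by rewrite fq.
  by exists (q y); [exists y | exact: fq].
have image_nbhs y (M : set plane) :
    N y -> nbhs y M -> nbhs (q y) (q @` (M `&` N)).
  move=> Ny My; have : nbhs y (M `&` N).
    by apply: filterI => //; exact: open_nbhs_nbhs.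
  move=> /(lattice_quotient_open qP (NA _ Ny)); apply: filterS.
  by apply: image_subset => z [].
have oU : open (q @` N).
  rewrite openE => _ [y Ny <-]; apply: filterS (image_nbhs y setT Ny filterT).
  by rewrite setTI.
exists (q @` N), f, q; rewrite fU; split=> //.
- by split=> //; exists x => //; split.
- by move=> _ /set_mem[y Ny <-]; rewrite fq.
- rewrite continuous_open_subspace // => _ /set_mem[y Ny <-] M.
  rewrite fq // => /(image_nbhs _ _ Ny); apply: filterS.
  by move=> _ [z [Mz Nz] <-] /=; rewrite fq.
- rewrite continuous_open_subspace // => y /set_mem /NA.
  exact: lattice_quotient_continuous.
Qed.

Lemma lattice_quotient_surface : surface R S.
Proof.
split; [exact: lattice_quotient_hausdorff|
  exact: lattice_quotient_second_countable|
  exact: lattice_quotient_connected|exact: lattice_quotient_chart].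
Qed.

End QuotientSurface.

(** * The torus and the four-punctured sphere *)

Section Torus.
Context {R : realType}.
Local Notation plane := (R * R)%type.

(** The topology below is put by hand on the quotient group, because
    [quotient_topology] brings a choice structure of its own, which does not
    agree with the one underlying the group structure. *)
Definition torus : Type := Quotient.quot (@Z2 R).

HB.instance Definition _ := GRing.Zmodule.on torus.

Definition torus_pi (x : plane) : torus := \pi_(Quotient.quot (@Z2 R)) x.

Let torus_open (U : set torus) := open (torus_pi @^-1` U).

Let torus_openT : torus_open setT.
Proof. exact: openT. Qed.

Let torus_openI (U V : set torus) :
  torus_open U -> torus_open V -> torus_open (U `&` V).
Proof. exact: openI. Qed.

Let torus_open_bigU (I : Type) (F : I -> set torus) :
  (forall i, torus_open (F i)) -> torus_open (\bigcup_i F i).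
Proof. by move=> oF; apply: bigcup_open => i _; exact: oF. Qed.

HB.instance Definition _ :=
  isOpenTopological.Build torus torus_openT torus_openI torus_open_bigU.

Lemma torus_pi_is_zmod_morphism : zmod_morphism torus_pi.
Proof. exact: (@pi_is_zmod_morphism plane _ _ (Quotient.quot (@Z2 R))). Qed.
HB.instance Definition _ :=
  GRing.isZmodMorphism.Build plane torus torus_pi torus_pi_is_zmod_morphism.

Lemma torus_pi_eq x y : torus_pi x = torus_pi y <-> y - x \in Z2.
Proof.
rewrite -[y - x]opprB rpredN.
have -> : (x - y \in Z2) = (x == y %[mod (Quotient.quot (@Z2 R))]).
  exact: Quotient.idealrBE.
by split=> [xy|/eqP//]; exact/eqP.
Qed.

Lemma torus_pi_lattice_quotient : lattice_quotient false torus_pi.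
Proof.
split=> [x y _ _|s|U].
- rewrite torus_pi_eq; split=> [xy|[[]//= _ xy]//].
  by exists false.
- by exists (repr (s : (Quotient.quot (@Z2 R)))) => //; rewrite /torus_pi reprK.
- by rewrite (_ : free_locus false = setT) ?setTI //; apply/seteqP; split.
Qed.

(** Subtraction on the torus is covered by subtraction on the plane, through the
    open map [torus_pi]. *)
Lemma torus_sub_continuous : continuous (fun x : torus * torus => x.1 - x.2).
Proof.
have qP := torus_pi_lattice_quotient; have [_ qsurj _] := qP.
move=> [s t]; have [x Ax <-] := qsurj s; have [y Ay <-] := qsurj t => N /=.
rewrite -raddfB => nN.
have /(lattice_quotient_continuous qP) cont : free_locus false (x - y) by [].
have sub : {for (x, y), continuous (fun z : plane * plane => z.1 - z.2)}.
  by apply: cvgB; [exact: cvg_fst | exact: cvg_snd].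
have [[M M'] /= [Mx My] MM'] := sub _ (cont _ nN).
exists (torus_pi @` (M `&` free_locus false),
        torus_pi @` (M' `&` free_locus false)).
  by split; exact: (lattice_quotient_open qP).
move=> [_ _] /= [[x' [Mx' _] <-] [y' [My' _] <-]].
by rewrite -raddfB; exact: (MM' (x', y')).
Qed.
HB.instance Definition _ :=
  PreTopologicalNmodule_isTopologicalZmodule.Build torus torus_sub_continuous.

End Torus.
Arguments torus R : clear implicits.

Section PuncturedSphere.
Context {R : realType}.
Local Notation plane := (R * R)%type.

(** The plane modulo this group is a sphere, the pillowcase; its four cone
    points are the classes of the half-integral points, which the free locus
    leaves out. *)
Definition pillowcase_group_set : set (plane -> plane) :=
  [set f | exists e t, t \in Z2 /\ forall x, f x = flip e x + t].

Lemma pillowcase_group_id : pillowcase_group_set id.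
Proof. by exists false, 0; split=> [|x]; rewrite ?rpred0 //= addr0. Qed.

Lemma pillowcase_group_comp f g : pillowcase_group_set f ->
  pillowcase_group_set g -> pillowcase_group_set (f \o g).
Proof.
move=> [e [t [tZ fE]]] [e' [t' [tZ' gE]]].
exists (e (+) e'), (flip e t' + t); split; first by rewrite rpredD ?flip_Z2.
move=> x; rewrite /= fE gE flipD addrA; congr (_ + _ + _).
by case: e {fE}; case: e' {gE} => //=; rewrite opprK.
Qed.

Lemma pillowcase_group_inv f : pillowcase_group_set f ->
  exists g, [/\ pillowcase_group_set g, cancel f g & cancel g f].
Proof.
move=> [e [t [tZ fE]]]; exists (fun x => flip e x - flip e t); split.
- by exists e, (- flip e t); split=> //; rewrite rpredN flip_Z2.
- by move=> x; rewrite fE flipD addrK flipK.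
- by move=> x; rewrite fE flipB !flipK subrK.
Qed.

Definition pillowcase_group : transformation_group plane :=
  TransformationGroup pillowcase_group_id pillowcase_group_comp
    pillowcase_group_inv.

Definition punctured_sphere : topologicalType :=
  orbit_space pillowcase_group (free_locus true).

Lemma fourth_free_point : free_locus true ((4^-1, 4^-1) : plane).
Proof. by move=> _; rewrite Z2P negb_and double_fourth_not_int. Qed.

Definition punctured_sphere_pi (x : plane) : punctured_sphere :=
  orbit pillowcase_group
    (insubd
      (SigSub (mem_set fourth_free_point) : set_type (free_locus true)) x).

Lemma punctured_sphere_pi_val (x : free_locus true) :
  punctured_sphere_pi (\val x) = orbit pillowcase_group x.
Proof. by rewrite /punctured_sphere_pi valKd. Qed.

Lemma punctured_sphere_pi_lattice_quotient :
  lattice_quotient true punctured_sphere_pi.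
Proof.
split=> [x y Ax Ay|s|U].
- rewrite (punctured_sphere_pi_val (SigSub (mem_set Ax))).
  rewrite (punctured_sphere_pi_val (SigSub (mem_set Ay))).
  rewrite orbit_eq /=; split=> [[_ [e [t [tZ ->]]] <-]|[e _ xy]].
    by exists e; rewrite ?implybT // addrC addKr.
  exists (fun z => flip e z + (y - flip e x)); last by rewrite addrC subrK.
  by exists e, (y - flip e x).
- have [x <-] := orbit_surj s; exists (\val x); first exact: set_valP.
  by rewrite punctured_sphere_pi_val.
- rewrite open_orbit_space; split=> [[V oV VU]|oU].
    rewrite (_ : _ `&` _ = free_locus true `&` V).
      by apply: openI => //; exact: open_free_locus.
    apply/seteqP; split=> x [Ax Ux]; split=> //; move: Ux;
      rewrite /= (punctured_sphere_pi_val (SigSub (mem_set Ax)));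
      by rewrite -[U _]/((orbit pillowcase_group (A := _) @^-1` U) _) -VU.
  exists (free_locus true `&` punctured_sphere_pi @^-1` U) => //.
  apply/seteqP; split=> [x [_]|x Ux] /=.
    by rewrite punctured_sphere_pi_val.
  by split; [exact: set_valP | rewrite /= punctured_sphere_pi_val].
Qed.

End PuncturedSphere.
Arguments punctured_sphere R : clear implicits.

(** * Coordinates of complex numbers along a lattice *)

Section ComplexPlane.
Context {R : realType}.
Local Notation plane := (R * R)%type.

Lemma complex_nbhs_gt0 (z : R[i]^o) (N : set R[i]^o) : nbhs z N ->
  exists2 e : R, 0 < e & forall w : R[i]^o, `|z - w| < e%:C%C -> N w.
Proof.
move=> /nbhs_ballP[e /= e0 eN]; have eE : (complex.Re e)%:C%C = e.
  by apply: RRe_real; exact: gtr0_real.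
exists (complex.Re e); first by rewrite -ltcR eE.
by move=> w; rewrite eE => zw; apply: eN; rewrite -ball_normE.
Qed.

Lemma Re_continuous : continuous (@complex.Re R : R[i]^o -> R).
Proof.
move=> z N /nbhs_ballP[e /= e0 eN]; apply/nbhs_ballP.
exists e%:C%C; rewrite /= ?ltcR // => w; rewrite -ball_normE /= => zw.
apply: eN; rewrite -ball_normE /= -ltcR; apply: le_lt_trans zw.
by apply: le_trans (normc_ge_Re _); case: z w => ? ? [].
Qed.

Lemma Im_continuous : continuous (@complex.Im R : R[i]^o -> R).
Proof.
have -> : @complex.Im R = (fun z => - complex.Re (z * 'i%C)) :> (R[i]^o -> R).
  by apply/funext => z; rewrite ReiNIm opprK.
have mulic : continuous (fun z : R[i]^o => z * 'i%C : R[i]^o).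
  exact: mulrr_continuous.
have reic : continuous (fun z : R[i]^o => complex.Re (z * 'i%C) : R).
  by move=> z; exact: (continuous_comp (mulic z) (@Re_continuous _)).
by move=> z; exact: (continuous_comp (reic z) (@opp_continuous _ _)).
Qed.

Lemma real_complex_continuous : continuous (real_complex R : R -> R[i]^o).
Proof.
move=> a N /complex_nbhs_gt0[e e0 eN]; apply/nbhs_ballP; exists e => //= b.
rewrite -ball_normE /= => ab; apply: eN.
by rewrite -rmorphB normc_def /= expr0n /= addr0 sqrtr_sqr ltcR.
Qed.

Variable alpha : R[i].
(** Real coordinates along the basis [1], [alpha] of the complex numbers; the
    inverse map is [lattice_point], and [Lambda alpha] corresponds to [Z2]. *)
Definition lattice_coord (z : R[i]) : plane :=
  (complex.Re z - complex.Im z / complex.Im alpha * complex.Re alpha,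
   complex.Im z / complex.Im alpha).

Definition lattice_point (x : plane) : R[i] := (x.1%:C + x.2%:C * alpha)%C.

Lemma Re_lattice_point x :
  complex.Re (lattice_point x) = x.1 + x.2 * complex.Re alpha.
Proof.
by rewrite /lattice_point; case: alpha => a c /=; rewrite mul0r subr0.
Qed.

Lemma Im_lattice_point x :
  complex.Im (lattice_point x) = x.2 * complex.Im alpha.
Proof.
by rewrite /lattice_point; case: alpha => a c /=; rewrite mul0r addr0 add0r.
Qed.

Hypothesis alpha_im : 0 < complex.Im alpha.

Lemma lattice_coordK : cancel lattice_coord lattice_point.
Proof.
move=> z; apply/eqP; rewrite eq_complex Re_lattice_point Im_lattice_point /=.
by rewrite subrK divfK ?eqxx ?gt_eqF.
Qed.

Lemma lattice_pointK : cancel lattice_point lattice_coord.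
Proof.
case=> a c; rewrite /lattice_coord Re_lattice_point Im_lattice_point /=.
by rewrite mulfK ?gt_eqF // addrK.
Qed.

Lemma lattice_point_is_zmod_morphism : zmod_morphism lattice_point.
Proof. by move=> x y; rewrite /lattice_point /= !rmorphB /=; ring. Qed.
HB.instance Definition _ :=
  GRing.isZmodMorphism.Build plane R[i] lattice_point
    lattice_point_is_zmod_morphism.

Lemma lattice_coord_is_zmod_morphism : zmod_morphism lattice_coord.
Proof.
by case=> a c [a' c']; rewrite /lattice_coord /=; congr (_, _) => /=; ring.
Qed.
HB.instance Definition _ :=
  GRing.isZmodMorphism.Build R[i] plane lattice_coord
    lattice_coord_is_zmod_morphism.

Lemma lattice_coord_Z2 z : Lambda alpha z <-> lattice_coord z \in Z2.
Proof.
split=> [[m [n zE]]|].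
  have -> : lattice_coord z = (m%:~R, n%:~R).
    by rewrite zE -[RHS]lattice_pointK /lattice_point /= !rmorph_int.
  by rewrite Z2P !intr_int.
rewrite Z2P => /andP[/intrP[m mE] /intrP[n nE]]; exists m, n.
by rewrite -[z]lattice_coordK /lattice_point mE nE !rmorph_int.
Qed.

Lemma lattice_coord_continuous : continuous (lattice_coord : R[i]^o -> plane).
Proof.
have imc : continuous (fun z : R[i]^o => complex.Im z / complex.Im alpha : R).
  move=> z.
  exact: (continuous_comp (@Im_continuous z) (@mulrr_continuous R _ _)).
have imac : continuous (fun z : R[i]^o =>
    complex.Im z / complex.Im alpha * complex.Re alpha : R).
  by move=> z; exact: (continuous_comp (imc z) (@mulrr_continuous R _ _)).
move=> z; apply: (@cvg_pair _ _ _ (nbhs z) (nbhs _) (nbhs _)); last exact: imc.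
exact: (@cvgB _ _ _ (nbhs z) _ _ _ _ _ (@Re_continuous z) (imac z)).
Qed.

Lemma lattice_point_continuous : continuous (lattice_point : plane -> R[i]^o).
Proof.
move=> x; apply: (@cvgD _ _ _ (nbhs x)).
  by apply: continuous_comp; [exact: cvg_fst | exact: real_complex_continuous].
have c2 : continuous (fun y : plane => y.2%:C%C : R[i]^o).
  move=> y.
  by apply: continuous_comp; [exact: cvg_snd | exact: real_complex_continuous].
exact: (continuous_comp (c2 x) (@mulrr_continuous R[i] _ _)).
Qed.

End ComplexPlane.

(** * Affine coordinates on a complex vector space *)

Section AffineCoordinates.
Context {R : realType}.
Local Notation C := R[i].

Lemma affine_form_continuous (T : topologicalType) m (f : 'I_m -> T -> C^o)
    (c : 'I_m -> C) (e : C) : (forall j, continuous (f j)) ->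
  continuous (fun z => \sum_j f j z * c j + e : C^o).
Proof.
move=> cf.
have sum_cont : continuous (fun z => \sum_j f j z * c j : C^o).
  apply: continuous_big => [|j _ z]; first exact: add_continuous.
  exact: (continuous_comp (cf j z) (@mulrr_continuous C _ _)).
move=> z.
by apply: (@cvgD C C^o T (nbhs z)); [exact: sum_cont | exact: cvg_cst].
Qed.

Lemma rV_continuous (T : topologicalType) (U : topologicalType) m
    (f : T -> 'rV[U]_m) :
  (forall j, continuous (fun x => f x 0 j)) -> continuous f.
Proof.
move=> cf x N [P fxP PN].
have : \forall y \near x, forall j, P 0 j (f y 0 j).
  by apply: filter_forall => j; exact: (cf j x _ (fxP 0 j)).
by apply: filterS => y Py; apply: PN => i j; rewrite (ord1 i).
Qed.

Variables (V : vectType C) (n : nat) (L : 'Hom(V, 'rV[C]_n)) (p : 'rV[C]_n).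

Local Notation basis_row v :=
  (\row_i coord (vbasis {:V}) i v : 'rV[C^o]_(\dim {:V})).

Lemma affine_entry_continuous i :
  continuous (fun v : vect_topology V => (L v + p) 0 i : C^o).
Proof.
pose c j := L (vbasis {:V})`_j 0 i.
have -> : (fun v : vect_topology V => (L v + p) 0 i : C^o) =
    (fun v => \sum_j coord (vbasis {:V}) j v * c j + p 0 i).
  apply/funext => v; rewrite mxE; congr (_ + _).
  rewrite {1}(coord_vbasis (memvf v)) linear_sum summxE.
  by apply: eq_bigr => j _; rewrite linearZ mxE.
apply: affine_form_continuous => j v.
have cb : {for v, continuous (fun w : vect_topology V => basis_row w)}.
  exact: initial_continuous.
have cE : (fun w : vect_topology V => coord (vbasis {:V}) j w : C^o) =
    (fun M : 'rV[C^o]_(\dim {:V}) => M 0 j : C^o) \o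
    (fun w : vect_topology V => basis_row w).
  by apply/funext => w; rewrite /= mxE.
have := continuous_comp cb (@coord_continuous C _ _ 0 j (basis_row v)).
by rewrite -[X in continuous_at _ X -> _]cE.
Qed.

(** The injective affine map [v |-> L v + p] embeds [V]: the topology of [V]
    is the one induced by the entries of [L v + p], because the coordinates of
    [v] are affine functions of these entries through a left inverse of [L]. *)
Lemma affine_entry_box (v : vect_topology V) N : lker L == 0%VS -> nbhs v N ->
  exists B : 'I_n -> set C^o, (forall i, nbhs ((L v + p) 0 i : C^o) (B i)) /\
    forall w : V, (forall i, B i ((L w + p) 0 i)) -> N w.
Proof.
move=> Linj [_ [[U oU <-] /= Uv] UN].
pose inv (z : 'rV[C^o]_n) := basis_row ((L^-1)%VF (z - p)).
have invL w : inv (L w + p) = basis_row w by rewrite /inv addrK lker0_lfunK.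
have inv_cont : continuous inv.
  apply: rV_continuous => j.
  pose c k := coord (vbasis {:V}) j ((L^-1)%VF (delta_mx 0 k)).
  pose e := coord (vbasis {:V}) j ((L^-1)%VF (- p)).
  have -> : (fun z : 'rV[C^o]_n => inv z 0 j) =
      (fun z => \sum_k z 0 k * c k + e).
    apply/funext => z; rewrite mxE linearD /= linearD /=; congr (_ + _).
    rewrite {1}(row_sum_delta z) linear_sum linear_sum.
    by apply: eq_bigr => k _; rewrite !linearZ.
  by apply: affine_form_continuous => k; exact: coord_continuous.
have : nbhs (inv (L v + p)) U by rewrite invL; exact: open_nbhs_nbhs.
move=> /inv_cont[B vB BU]; exists (B 0); split=> // w wB.
apply: UN; rewrite /= -invL; apply: BU => i j; rewrite (ord1 i); exact: wB.
Qed.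

End AffineCoordinates.

(** * Groups acting on tuples of points of the plane *)

Lemma tuples_continuous_at (T S : topologicalType) n (f : T -> tuples n S) x :
  (forall i, {for x, continuous (fun y => f y i)}) -> {for x, continuous f}.
Proof.
move=> cf; apply/cvg_sup => i N [_ [[U oU <-] /= Ux] UN].
have nU : nbhs x ((fun y => f y i) @^-1` U).
  by apply: (cf i); exact: open_nbhs_nbhs.
by apply: (@filterS _ (nbhs x) _ _ _ _ nU) => y Uy; exact: UN.
Qed.

Lemma nbhs_tuples_box (S : topologicalType) n (x : tuples n S)
    (B : 'I_n -> set S) :
  (forall i, nbhs (x i) (B i)) ->
  nbhs x [set y : tuples n S | forall i, B i (y i)].
Proof.
move=> xB.
apply: (@filter_forall _ _ (fun i (y : tuples n S) => B i (y i)) (nbhs x) _).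
move=> i.
exact: (@proj_continuous _ (fun=> S) i x _ (xB i)).
Qed.

Section LatticeAction.
Context {R : realType}.
Local Notation plane := (R * R)%type.
Variables (b : bool) (n : nat) (V : vectType R[i]).
Variables (W : transformation_group V) (kappa : V -> 'I_n -> plane).

(** The tuples that occur as coordinates of points of [V]: all of them in
    type C, where [b] is true, and those of sum zero in type A. *)
Definition balanced (z : 'I_n -> plane) := ~~ b -> \sum_i z i = 0.

Definition signed_action (e : 'I_n -> bool) (s : 'S_n) (t : 'I_n -> plane)
  (z : 'I_n -> plane) (i : 'I_n) : plane := flip (e i) (z (s i)) + t i.

Hypothesis kappa_inj : injective kappa.
Hypothesis kappa_image : forall z, balanced z <-> exists v, kappa v = z.
Hypothesis W_action : forall f : V -> V, elements W f <->
  exists e s t, [/\ forall i, e i ==> b, forall i, t i \in Z2 &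
    forall v, kappa (f v) = signed_action e s t (kappa v)].

Lemma balanced_kappa v : balanced (kappa v).
Proof. by apply/kappa_image; exists v. Qed.

(** A signed action need not preserve balanced tuples when [b] is false: the sum
    of [t] has to vanish.  It does as soon as one balanced tuple is sent to a
    balanced one, and the action then comes from an element of [W]. *)
Lemma element_with_value e s t v v' :
    (forall i, e i ==> b) -> (forall i, t i \in Z2) ->
    kappa v' = signed_action e s t (kappa v) ->
  exists f, [/\ elements W f, f v = v' &
    forall w, kappa (f w) = signed_action e s t (kappa w)].
Proof.
move=> eb tZ v'E.
have action_sum z : ~~ b ->
    \sum_i signed_action e s t z i = \sum_i z i + \sum_i t i.
  move=> bN; rewrite big_split /=; congr (_ + _).
  rewrite [RHS](reindex_inj (@perm_inj _ s)); apply: eq_bigr => i _.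
  by have := eb i; rewrite (negPf bN) implybF => /negPf->.
have sum_t : ~~ b -> \sum_i t i = 0.
  move=> bN; have := action_sum (kappa v) bN.
  by rewrite -v'E !balanced_kappa // add0r.
have /choice[f fE] : forall w, exists w',
    kappa w' = signed_action e s t (kappa w).
  move=> w; apply/kappa_image => bN.
  by rewrite action_sum // sum_t // balanced_kappa // addr0.
exists f; split=> //; last by apply: kappa_inj; rewrite fE.
by apply/W_action; exists e, s, t.
Qed.

Lemma lattice_orbit v v' : (exists2 f, elements W f & f v = v') <->
  exists s : 'S_n, forall i, lattice_equiv b (kappa v (s i)) (kappa v' i).
Proof.
split=> [[f /W_action[e [s [t [eb tZ fE]]]] <-]|[s vv']].
  exists s => i; exists (e i) => //.
  by rewrite fE /signed_action addrC addKr.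
have /choice[e eP] : forall i, exists e : bool,
    e ==> b /\ kappa v' i - flip e (kappa v (s i)) \in Z2.
  by move=> i; have [e eb vi] := vv' i; exists e.
have [|||f [Wf fv _]] := @element_with_value e s
    (fun i => kappa v' i - flip (e i) (kappa v (s i))) v v'.
- by move=> i; case: (eP i).
- by move=> i; case: (eP i).
- by apply/funext => i; rewrite /signed_action addrC subrK.
- by exists f.
Qed.

(** A half-integral point [kappa v i], or two equivalent points [kappa v i] and
    [kappa v j], give an element of [W] fixing [v], which changes the sign of
    the [i]-th point or exchanges the [i]-th and [j]-th points.  It is not the
    identity, as tests on tuples that vanish except at [i] and [j] show.
    Conversely, an element fixing such a [v] permutes inequivalent points, hence
    permutes nothing; free points exclude signs, and then translations. *)
Lemma lattice_regular v : regular_points W v <->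
  (forall i, free_locus b (kappa v i)) /\
  (forall i j, lattice_equiv b (kappa v i) (kappa v j) -> i = j).
Proof.
have one_neq0 : (1, 0) <> (0, 0) :> plane by case=> /eqP; rewrite oner_eq0.
have one_neqN : (1, 0) <> - (1, 0) :> plane by case; lra.
split=> [vreg|[vfree vdist] f /W_action[e [s [t [eb tZ fE]]]] fv].
  split=> [i bT|i j [e0 e0b]]; [apply/negP => iiZ | set t0 := _ - _ => t0Z].
    have [|||f [Wf fv fE]] := @element_with_value (fun j => j == i) 1%g
        (fun j => if j == i then kappa v i + kappa v i else 0) v v.
    - by move=> j; rewrite bT implybT.
    - by move=> j; case: ifP => // _; exact: rpred0.
    - apply/funext => j; rewrite /signed_action perm1.
      by case: eqP => [->|_] /=; rewrite ?addKr ?addr0.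
    have {}fE w : kappa w i = - kappa w i + (kappa v i + kappa v i).
      have := fE w; rewrite (vreg _ Wf fv) => /(congr1 (fun z => z i)) {1}->.
      by rewrite /signed_action perm1 eqxx.
    have at_x (x : plane) : x = - x + (kappa v i + kappa v i).
      have [|w wE] := (kappa_image (fun j => if j == i then x else 0)).1.
        by rewrite /balanced bT.
      by have := fE w; rewrite wE eqxx.
    have := at_x 0; rewrite oppr0 add0r => vv0.
    by have := at_x (1, 0); rewrite -vv0 addr0.
  apply/eqP/negPn/negP => ij; have ji : j != i by rewrite eq_sym.
  have [|||f [Wf fv fE]] := @element_with_value
      (fun k => if (k == i) || (k == j) then e0 else false) (tperm i j)
      (fun k => if k == j then t0 else if k == i then - flip e0 t0 else 0) v v.
  - by move=> k; case: ifP.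
  - move=> k; case: ifP => // _; case: ifP => // _; last exact: rpred0.
    by rewrite rpredN flip_Z2.
  - apply/funext => k; rewrite /signed_action.
    case: tpermP => [->|->|/eqP/negPf-> /eqP/negPf->]; last by rewrite /= addr0.
      by rewrite eqxx (negPf ij) /= /t0 -flipB opprB addrC subrK flipK.
    by rewrite eqxx orbT /= /t0 addrC subrK.
  (* as [f] is the identity, this relation holds at every [w] *)
  have {}fE w : kappa w j = flip e0 (kappa w i) + t0.
    have := fE w; rewrite (vreg _ Wf fv) => /(congr1 (fun z => z j)) {1}->.
    by rewrite /signed_action tpermR eqxx orbT.
  (* the test tuple has sum zero when [e0] is false, as type A requires *)
  have at_x (x : plane) : x = flip e0 (if e0 then 0 else - x) + t0.
    have [|w wE] := (kappa_image (fun k =>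
        if k == j then x else if k == i then (if e0 then 0 else - x) else 0)).1.
      move=> bN; have /negPf-> : ~~ e0 by apply: contra bN; exact: implyP.
      rewrite (bigD1 j) //= (bigD1 i) //= eqxx (negPf ij) eqxx.
      rewrite addrA subrr add0r.
      by apply: big1 => k /andP[/negPf-> /negPf->].
    by have := fE w; rewrite wE eqxx (negPf ij) eqxx.
  have t00 : t0 = 0.
    have := at_x 0; rewrite oppr0 if_same.
    have -> : flip e0 0 = 0 :> plane by case: (e0); rewrite //= oppr0.
    by rewrite add0r => <-.
  by have := at_x (1, 0); rewrite t00 addr0; case: (e0) => /=; rewrite ?oppr0.
have sE i : s i = i.
  apply: vdist; exists (e i) => //.
  by rewrite -{1}fv fE /signed_action addrC addKr.
have key i : kappa v i = flip (e i) (kappa v i) + t i.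
  by rewrite -{1}fv fE /signed_action sE.
have eE i : e i = false.
  apply/negP => ei; have bT : b by have := eb i; rewrite ei.
  have /negP := vfree i bT; apply.
  by rewrite {1}(key i) ei /= addrAC addNr add0r.
apply/funext => w; apply: kappa_inj; apply/funext => i.
have := key i; rewrite eE /= => /esym/eqP; rewrite -subr_eq0 addrAC subrr add0r.
by move=> /eqP t0; rewrite fE /signed_action sE eE t0 /= addr0.
Qed.

Variables (S : topologicalType) (q : plane -> S) (P : set (tuples n S)).
Hypothesis qP : lattice_quotient b q.
Hypothesis P_balanced : forall z : 'I_n -> plane,
  P (fun i => q (z i)) <-> (~~ b -> \sum_i z i \in Z2).
Hypothesis kappa_continuous :
  forall i, continuous (fun v : vect_topology V => kappa v i).
Hypothesis kappa_box : forall (v : vect_topology V) N, nbhs v N ->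
  exists B : 'I_n -> set plane, (forall i, nbhs (kappa v i) (B i)) /\
    forall w : V, (forall i, B i (kappa w i)) -> N w.

(** Arbitrary lifts of the points work in type C.  In type A their sum is only
    known to be integral; subtracting it from one of the lifts gives a tuple of
    sum zero over the same configuration. *)
Lemma configuration_lift (x : 'I_n -> S) : P x ->
  exists v, forall i, free_locus b (kappa v i) /\ q (kappa v i) = x i.
Proof.
have [qeq qsurj _] := qP.
have /choice[z zP] : forall i, exists z, free_locus b z /\ q z = x i.
  by move=> i; have [z ? ?] := qsurj (x i); exists z.
have xE : x = (fun i => q (z i)) by apply/funext => i; case: (zP i).
rewrite {1}xE => /P_balanced zsum.
suff [v vz] : exists v, forall i, lattice_equiv b (z i) (kappa v i).
  exists v => i; have [zfree <-] := zP i.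
  have vfree := lattice_equiv_free (vz i) zfree.
  by split=> //; apply/esym/qeq.
have [bT|bN] := boolP b.
  have [|v vE] := (kappa_image z).1; first by rewrite /balanced bT.
  by exists v => i; rewrite vE; exact: lattice_equiv_refl.
(* without points, the empty tuple has sum zero *)
have [i0|no_i] := pselect (exists i0 : 'I_n, True); last first.
  have [|v vE] := (kappa_image z).1.
    by move=> _; apply: big1 => i _; case: no_i; exists i.
  by exists v => i; rewrite vE; exact: lattice_equiv_refl.
have {i0}[i0 _] := i0.
have [|v vE] := (kappa_image (fun i =>
    if i == i0 then z i - \sum_j z j else z i)).1.
  move=> _; rewrite (bigD1 i0) //= eqxx.
  rewrite [X in _ + X](eq_bigr z); last by move=> k /negPf->.
  have sumE : \sum_j z j = z i0 + \sum_(j | j != i0) z j by rewrite (bigD1 i0).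
  by rewrite addrAC -sumE subrr.
exists v => i; rewrite vE; case: ifP => _; last exact: lattice_equiv_refl.
by exists false; rewrite //= addrAC subrr add0r rpredN zsum.
Qed.

(** Integral vectors of norm less than 1 vanish; radius 1/(n+1) around each of
    the [n] points keeps the sum that small. *)
Lemma balanced_near (z : 'I_n -> plane) : balanced z ->
  exists B : 'I_n -> set plane, (forall i, nbhs (z i) (B i)) /\
    forall z', (forall i, B i (z' i)) ->
      (~~ b -> \sum_i z' i \in Z2) -> balanced z'.
Proof.
move=> zbal; exists (fun i => ball (z i) (n.+1%:R^-1 : R)).
split=> [i|z' zz' z'Z bN].
  by apply: nbhsx_ballx; rewrite invr_gt0.
apply: small_Z2; first exact: z'Z.
have -> : \sum_i z' i = \sum_i (z' i - z i) by rewrite sumrB zbal // subr0.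
apply: le_lt_trans (ler_norm_sum _ _ _) _.
apply: (@le_lt_trans _ _ (\sum_(i < n) n.+1%:R^-1)).
  apply: ler_sum => i _; have := zz' i; rewrite -ball_normE /= distrC => /ltW.
  by [].
rewrite sumr_const card_ord -[X in X < _]mulr_natl.
by rewrite ltr_pdivrMr // mul1r ltr_nat.
Qed.

Theorem homeomorphic_configurations :
  homeomorphic (regular_orbit_space W) (unordered_configurations P).
Proof.
have [qeq qsurj qopen] := qP.
have dist v : regular_points W v -> injective (fun i => q (kappa v i)).
  move=> /lattice_regular[vfree vdist] i j.
  by move=> /(qeq _ _ (vfree i) (vfree j)); exact: vdist.
apply: (@homeomorphic_orbit_spaces (vect_topology V) (tuples n S) W
  (Defs.permutations n S) (regular_points W) _ (fun v i => q (kappa v i))).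
- move=> v vreg; split; first exact: dist.
  by apply/P_balanced => bN; rewrite balanced_kappa // rpred0.
- move=> v /lattice_regular[vfree _]; apply: tuples_continuous_at => i.
  apply: (@continuous_comp _ _ _ (fun w : vect_topology V => kappa w i) q).
    exact: kappa_continuous.
  exact: (lattice_quotient_continuous qP (vfree i)).
- move=> x [xinj /configuration_lift[v vP]].
  exists v; last by apply/funext => i; case: (vP i).
  apply/lattice_regular; split=> [i|i j]; first by case: (vP i).
  have [vi qi] := vP i; have [vj qj] := vP j.
  by move=> /(qeq _ _ vi vj); rewrite qi qj; exact: xinj.
- move=> v N /lattice_regular[vfree _] /kappa_box[B [vB BN]].
  have [B' [vB' B'bal]] := balanced_near (balanced_kappa v).
  have nimage i : nbhs (q (kappa v i)) (q @` ((B i `&` B' i) `&` free_locus b)).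
    by apply: (lattice_quotient_open qP (vfree i)); exact: filterI.
  have nbox := nbhs_tuples_box nimage.
  apply: (@filterS (tuples n S) (nbhs _) _ _ _ _ nbox) => x xB [xinj Px].
  have /choice[z zP] : forall i, exists z,
      [/\ B i z, B' i z, free_locus b z & q z = x i].
    by move=> i; have [z [[? ?] ?] ?] := xB i; exists z.
  have xE : x = (fun i => q (z i)) by apply/funext => i; case: (zP i).
  have [|w wE] := (kappa_image z).1.
    apply: B'bal => [i|]; first by case: (zP i).
    by apply/P_balanced; rewrite -xE.
  exists w; rewrite wE; split=> //; last first.
    by apply: BN => i; rewrite wE; case: (zP i).
  apply/lattice_regular; rewrite wE; split=> [i|i j]; first by case: (zP i).
  have [_ _ vi qi] := zP i; have [_ _ vj qj] := zP j.
  by move=> /(qeq _ _ vi vj); rewrite qi qj; exact: xinj.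
- move=> v v' /lattice_regular[vfree _] /lattice_regular[vfree' _].
  rewrite lattice_orbit; split=> [[s sP]|[h [s hs] hv]].
    exists (fun x : 'I_n -> S => x \o s); first by exists s.
    by apply/funext => i; apply/qeq.
  by exists s => i; apply/qeq => //; rewrite -(hs (fun i => q (kappa v i))) hv.
Qed.

End LatticeAction.

(** * The two families *)

Section CoordinatesOfGroup.
Context {R : realType}.
Local Notation C := R[i].
Local Notation plane := (R * R)%type.
Variable alpha : C.
Hypothesis alpha_im : 0 < complex.Im alpha.
Local Notation coord_of := (lattice_coord alpha).
Local Notation point_of := (lattice_point alpha).

Lemma lattice_coord_flip (e : bool) (z w : C) :
  coord_of ((-1) ^+ e * z + w) = flip e (coord_of z) + coord_of w.
Proof. by rewrite raddfD; case: e; rewrite ?mulN1r ?raddfN ?mul1r. Qed.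

Lemma row_perm_entry n (x : 'rV[C]_n) (s : 'S_n) j :
  (x *m perm_mx s) 0 j = x 0 ((s^-1)%g j).
Proof. by rewrite -[s in LHS]invgK -col_permE mxE. Qed.

Lemma signed_perm_entry n (x : 'rV[C]_n) e (s : 'S_n) j :
  (x *m signed_perm_mx e s) 0 j =
  (-1) ^+ e ((s^-1)%g j) * x 0 ((s^-1)%g j).
Proof.
by rewrite /signed_perm_mx mulmxA row_perm_entry mul_mx_diag !mxE mulrC.
Qed.

Section Coordinates.
Variables (V : vectType C) (n : nat) (L : 'Hom(V, 'rV[C]_n)) (p : 'rV[C]_n).
Hypothesis L_inj : lker L == 0%VS.

(** This is the map [kappa] of the previous part for both families. *)
Definition affine_coord (v : V) (i : 'I_n) : plane := coord_of ((L v + p) 0 i).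

Lemma affine_coord_eq v w :
  affine_coord v = w -> L v + p = \row_i point_of (w i).
Proof.
by move=> <-; apply/rowP => i; rewrite [RHS]mxE /affine_coord lattice_coordK.
Qed.

Lemma affine_coord_inj : injective affine_coord.
Proof.
move=> v w /affine_coord_eq.
rewrite -(affine_coord_eq (erefl (affine_coord w))).
by move=> /addIr; exact: (lker0P L_inj).
Qed.

Lemma affine_coord_continuous i :
  continuous (fun v : vect_topology V => affine_coord v i).
Proof.
move=> v.
apply: (@continuous_comp (vect_topology V) C^o plane
  (fun w => (L w + p) 0 i) coord_of v); first exact: affine_entry_continuous.
exact: lattice_coord_continuous.
Qed.

Lemma affine_coord_box (v : vect_topology V) N : nbhs v N ->
  exists B : 'I_n -> set plane, (forall i, nbhs (affine_coord v i) (B i)) /\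
    forall w : V, (forall i, B i (affine_coord w i)) -> N w.
Proof.
move=> /(affine_entry_box p L_inj)[B [vB BN]].
exists (fun i => point_of @^-1` B i); split=> [i|w wB].
  by apply: lattice_point_continuous; rewrite lattice_coordK //; exact: vB.
by apply: BN => i; have := wB i; rewrite /= lattice_coordK.
Qed.

End Coordinates.

Lemma typeC_configurations n (V : vectType C) (W : transformation_group V) :
    affinely_equivalent (elements W) (typeC_group alpha (n := n)) ->
  homeomorphic (regular_orbit_space W)
    (@unordered_configurations n (punctured_sphere R) setT).
Proof.
move=> [L [p [L_inj L_surj W_iff]]].
pose kappa := affine_coord L p.
have kappa_surj z : exists v, kappa v = z.
  exists ((L^-1)%VF (\row_i point_of (z i) - p)); apply/funext => i.
  rewrite /kappa /affine_coord limg_lfunVK ?L_surj ?memvf // subrK.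
  by rewrite mxE lattice_pointK.
apply: (@homeomorphic_configurations R true n V W kappa _ _ _ _
  punctured_sphere_pi).
- exact: affine_coord_inj.
- by move=> z; split.
- move=> f; split=> [/W_iff[f' [e [s [t [tL f'E]]]] fE]|[e [s [t [_ tZ fE]]]]].
    exists (e \o (s^-1)%g), (s^-1)%g, (fun i => coord_of (t 0 i)); split.
    - by move=> i; exact: implybT.
    - by move=> i; exact/lattice_coord_Z2.
    move=> v; apply/funext => i; rewrite /kappa /affine_coord fE f'E mxE.
    by rewrite signed_perm_entry lattice_coord_flip.
  pose t' := \row_i point_of (t i).
  apply/W_iff.
  exists (fun z => z *m signed_perm_mx (e \o (s^-1)%g) (s^-1)%g + t').
    exists (e \o (s^-1)%g), (s^-1)%g, t'; split=> // i.
    by apply/lattice_coord_Z2 => //; rewrite mxE lattice_pointK.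
  move=> v; rewrite (affine_coord_eq (fE v)); apply/rowP => i; rewrite mxE.
  apply: (can_inj (lattice_coordK alpha_im)); rewrite lattice_pointK //.
  rewrite mxE signed_perm_entry lattice_coord_flip invgK /= permK.
  by rewrite [t' 0 i]mxE lattice_pointK.
- exact: punctured_sphere_pi_lattice_quotient.
- by move=> z; split.
- exact: affine_coord_continuous.
- exact: affine_coord_box.
Qed.

Lemma zero_sum_perm n (z : 'rV[C]_n) (s : 'S_n) :
  z \in zero_sum n -> z *m perm_mx s \in zero_sum n.
Proof.
rewrite !zero_sumP => /eqP z0.
rewrite -[X in _ == X]z0 (reindex_inj (@perm_inj _ s)).
by apply/eqP; apply: eq_bigr => i _; rewrite row_perm_entry permK.
Qed.

Lemma typeA_configurations n (V : vectType C) (W : transformation_group V) :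
    affinely_equivalent (elements W) (typeA_group alpha (n := n)) ->
  homeomorphic (regular_orbit_space W)
    (@unordered_configurations n (torus R)
      [set x : 'I_n -> torus R | \sum_(i < n) x i = 0]).
Proof.
move=> [L0 [p0 [L0_inj L0_surj W_iff]]].
pose L : 'Hom(V, 'rV[C]_n) := (linfun vsval \o L0)%VF.
pose p := vsval p0.
have LE v : L v + p = vsval (L0 v + p0) by rewrite /L lfunE /= lfunE /=.
have L_inj : lker L == 0%VS.
  apply/lker0P => v w; rewrite /L !lfunE /= !lfunE /= => /subvs_inj.
  exact: (lker0P L0_inj).
pose kappa := affine_coord L p.
have kappa_image z : balanced false z <-> exists v, kappa v = z.
  split=> [/(_ isT) z0|[v <-] _].
    pose r : 'rV[C]_n := \row_i point_of (z i).
    have r0 : r \in zero_sum n.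
      rewrite zero_sumP; under eq_bigr do rewrite mxE.
      by rewrite -raddf_sum z0 raddf0.
    exists ((L0^-1)%VF (vsproj _ r - p0)); apply/funext => i.
    rewrite /kappa /affine_coord LE limg_lfunVK ?L0_surj ?memvf // subrK.
    by rewrite vsprojK // mxE lattice_pointK.
  rewrite /kappa /affine_coord -raddf_sum LE.
  by have := subvsP (L0 v + p0); rewrite zero_sumP => /eqP->; rewrite raddf0.
apply: (@homeomorphic_configurations R false n V W kappa _ _ _ _ torus_pi).
- exact: affine_coord_inj.
- exact: kappa_image.
- move=> f; split=> [/W_iff[f' [s [t [tL f'E]]] fE]|[e [s [t [e0 tZ fE]]]]].
    exists (fun=> false), (s^-1)%g, (fun i => coord_of (vsval t 0 i)).
    split=> //.
      by move=> i; exact/lattice_coord_Z2.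
    move=> v; apply/funext => i; rewrite /kappa /affine_coord LE fE f'E mxE.
    by rewrite row_perm_entry raddfD LE.
  have eE i : e i = false by have := e0 i; rewrite implybF => /negPf.
  (* an element of [W] preserves sum zero, which determines the sum of [t] *)
  have t_sum : \sum_i t i = 0.
    have [_ +] := kappa_image (kappa (f 0)).
    have [_ +] := kappa_image (kappa 0).
    move=> /(_ (ex_intro _ _ erefl) isT) k0 /(_ (ex_intro _ _ erefl) isT).
    rewrite fE big_split /=; under eq_bigr do rewrite eE /=.
    have -> : \sum_i kappa 0 (s i) = 0.
      by rewrite -[RHS]k0 [RHS](reindex_perm s).
    by rewrite add0r.
  pose t' := \row_i point_of (t i).
  have t'0 : t' \in zero_sum n.
    rewrite zero_sumP; under eq_bigr do rewrite mxE.
    by rewrite -raddf_sum t_sum raddf0.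
  apply/W_iff.
  exists (fun z => vsproj (zero_sum n) (vsval z *m perm_mx (s^-1)%g + t')).
    exists (s^-1)%g, (vsproj _ t'); split=> [i|z].
      by apply/lattice_coord_Z2 => //; rewrite vsprojK // mxE lattice_pointK.
    by rewrite !vsprojK // rpredD // zero_sum_perm // subvsP.
  move=> v; apply: subvs_inj.
  rewrite -LE (affine_coord_eq (fE v)) vsprojK; last first.
    by rewrite rpredD // zero_sum_perm // subvsP.
  apply/rowP => i; rewrite mxE.
  apply: (can_inj (lattice_coordK alpha_im)); rewrite lattice_pointK //.
  rewrite -LE mxE row_perm_entry raddfD /= [t' 0 i]mxE lattice_pointK //.
  by rewrite invgK /signed_action eE.
- exact: torus_pi_lattice_quotient.
- move=> z; rewrite /= -raddf_sum; split=> [z0 _|/(_ isT) zZ].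
    have := (torus_pi_eq 0 (\sum_i z i)).1; rewrite subr0; apply.
    by rewrite raddf0; exact/esym.
  by rewrite -(raddf0 (@torus_pi R)); apply/esym/torus_pi_eq; rewrite subr0.
- exact: affine_coord_continuous.
- exact: affine_coord_box.
Qed.

End CoordinatesOfGroup.

Theorem lemma1p8 (R : realType) (alpha : R[i]) (n0 : nat)
    (V : nat -> vectType R[i]) (W : forall n : nat, transformation_group (V n)) :
  modular_strip alpha -> infinite_family alpha n0 W ->
  forall n : nat, (n0 <= n)%N -> configuration_space R n (regular_orbit_space (W n)).
Proof.
move=> [alpha_im _ _ _] [_ [typeA|typeC]] n n0n.
  right; exists (torus R); split.
    exact: (lattice_quotient_surface torus_pi_lattice_quotient).
  exact: (typeA_configurations alpha_im (typeA n n0n)).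
left; exists (punctured_sphere R); split.
  exact: (lattice_quotient_surface punctured_sphere_pi_lattice_quotient).
exact: (typeC_configurations alpha_im (typeC n n0n)).
Qed.
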